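(* Let $d\in\mathbb{N}$ and let $\varphi\colon(0,1)\to[0,d]$ be an increasing function. Then there exists a set $F\subset\mathbb{R}^d$ with $\dim_{\mathrm{A}}^{\theta}F=\varphi(\theta)$ for all $\theta\in(0,1)$ if and only if the function $\theta\mapsto(1-\theta)\varphi(\theta)$ is decreasing on $(0,1)$.
   Context: ''Increasing'' and ''decreasing'' are meant in the non-strict sense. $\mathbb{R}^d$ carries the Euclidean norm and $B(x,\delta)$ is the open ball of centre $x$ and radius $\delta$. For bounded $E\subset\mathbb{R}^d$ and $\delta>0$, $N_\delta(E)$ is the least number of balls of radius $\delta$ required to cover $E$. For $\theta\in(0,1)$ the Assouad spectrum of $F\subset\mathbb{R}^d$ is $$\dim_{\mathrm{A}}^{\theta}F=\inf\Bigl\{\alpha:(\exists C>0)(\forall\, 0<\delta\leq 1)(\forall x\in F)\ N_{\delta^{1/\theta}}(F\cap B(x,\delta))\leq C\Bigl(\frac{\delta}{\delta^{1/\theta}}\Bigr)^{\alpha}\Bigr\}.$$ *)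

(* Defs.v *)
From HB Require Import structures.
From mathcomp Require Import all_boot all_order all_algebra.
From mathcomp Require Import all_classical all_reals all_analysis.

Set Implicit Arguments.
Unset Strict Implicit.
Unset Printing Implicit Defensive.

Import Order.TTheory GRing.Theory Num.Theory.

Local Open Scope classical_set_scope.
Local Open Scope ring_scope.

(* The norm and the balls that the library puts on ['rV[R]_d] are those of the
   sup norm; the Euclidean ones are defined here. *)
Definition enorm (R : realType) (d : nat) (x : 'rV[R]_d) : R :=
  Num.sqrt (\sum_(i < d) x ord0 i ^+ 2).

Definition eball (R : realType) (d : nat) (x : 'rV[R]_d) (delta : R) :
    set 'rV[R]_d :=
  [set y | enorm (y - x) < delta].

Definition coverable (R : realType) (d : nat) (delta : R)
    (E : set 'rV[R]_d) (n : nat) : Prop :=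
  exists c : 'I_n -> 'rV[R]_d, E `<=` \bigcup_i eball (c i) delta.

(* An infimum of a set of naturals in [\bar R]: it is the least element when
   that set is nonempty (in particular for bounded [E] and [0 < delta]),
   and [+oo] otherwise. *)
Definition covering_number (R : realType) (d : nat) (delta : R)
    (E : set 'rV[R]_d) : \bar R :=
  ereal_inf [set (n%:R)%:E | n in [set n | coverable delta E n]].

(* The infimum is taken in [\bar R], over all real exponents: it is [-oo] for
   empty [F], and nonnegative for nonempty [F]. *)
Definition assouad_spectrum (R : realType) (d : nat) (theta : R)
    (F : set 'rV[R]_d) : \bar R :=
  ereal_inf [set alpha%:E | alpha in [set alpha : R |
    exists C : R, 0 < C /\
      forall delta : R, 0 < delta <= 1 -> forall x : 'rV[R]_d, F x ->
        (covering_number (delta `^ theta^-1) (F `&` eball x delta) <=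
          (C * (delta / delta `^ theta^-1) `^ alpha)%:E)%E]].

(* Main.v *)
Require Import Defs.
From mathcomp Require Import all_boot all_order all_algebra.
From mathcomp Require Import all_classical all_reals all_analysis.
From mathcomp Require Import zify ring lra.

(* Necessity: for a fixed small scale [rho] and [s <= t], the ball
   [B(x, rho ^ t)] lies in [B(x, rho ^ s)], and the exponents of the two
   covering bounds, taken as powers of [rho], are [(1 - t) phi(t)] and
   [(1 - s) phi(s)].

   Sufficiency: for each [theta] in a countable dense set, and at arbitrarily
   small scales [r], take a finite set that is homogeneous of dimension
   [phi(theta)] between the scales [r ^ theta] and [r] and trivial at all other
   scales; in each coordinate it consists of the numbers whose nonzero binary
   digits have prescribed positions, of density [phi(theta) / d].  If [phi] is
   increasing and [(1 - theta) phi(theta)] is decreasing, such a set never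
   exceeds the growth allowed by [phi] at any other parameter [t].  All these
   sets contain [0]; since their scales decrease superexponentially, at a given
   scale the finer ones fit in one ball around [0] and the coarser ones have
   negligible cardinality, so that only one of them matters.  The lower bound
   at all parameters follows from the dense ones by the necessity inequality
   and the monotonicity of [phi]. *)

Set Implicit Arguments.
Unset Strict Implicit.
Unset Printing Implicit Defensive.

Import Order.TTheory GRing.Theory Num.Theory.

Local Open Scope ring_scope.

(** * Natural numbers with prescribed binary digit positions *)

(* The binary digits of [m] may be nonzero only at the jumps of [f]. *)
Definition digits_at (f : nat -> nat) (m : nat) : Prop :=
  forall j, f j.+1 = f j -> ~~ odd (m %/ 2 ^ j).

(** Makes [f] a counting function of free positions: [f k - f j] of them lie in [[j, k)]. *)
Definition unit_steps (f : nat -> nat) : Prop :=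
  forall j, f j.+1 = f j \/ f j.+1 = (f j).+1.

Lemma unit_steps_le (f : nat -> nat) (j k : nat) :
  unit_steps f -> (j <= k)%N -> (f j <= f k)%N.
Proof.
move=> hf /subnK <-; elim: (k - j)%N => // n IHn; rewrite addSn.
by case: (hf (n + j)%N) => ->; lia.
Qed.

Lemma divn_expS (m j : nat) : (m %/ 2 ^ j.+1 = (m %/ 2 ^ j) %/ 2)%N.
Proof. by rewrite expnSr divnMA. Qed.

(** Descending induction from position [k]: a forced zero keeps the number of prefixes, a free digit
    doubles it. For [k <= j] the value [q] already determines the prefix. *)
Lemma digit_prefixes (f : nat -> nat) (j k q : nat) : unit_steps f ->
  exists2 t : seq nat, (size t <= 2 ^ (f k - f j))%N &
    forall m, digits_at f m -> (m %/ 2 ^ k)%N = q -> (m %/ 2 ^ j)%N \in t.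
Proof.
move=> hf; have [kj|jk] := leqP k j.
  exists [:: (q %/ 2 ^ (j - k))%N]; first by rewrite expn_gt0.
  by move=> m _ <-; rewrite inE -divnMA -expnD subnKC.
have -> : j = (k - (k - j))%N by lia.
have: (k - j <= k)%N by lia.
elim: (k - j)%N => [_|n IHn nk].
  by exists [:: q] => [|m _]; rewrite subn0 ?expn_gt0 // => ->; rewrite inE.
have [t st ht] := IHn (ltnW nk).
have e : (k - n)%N = (k - n.+1).+1 by lia.
set i := (k - n.+1)%N in e *; rewrite e in st ht.
have hm m : (m %/ 2 ^ i = odd (m %/ 2 ^ i) + (m %/ 2 ^ i.+1).*2)%N.
  by rewrite divn_expS divn2 odd_double_half.
have := @unit_steps_le f i.+1 k hf; case: (hf i) => fi ik.
- exists (map double t); first by rewrite size_map -fi.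
  move=> m hd mq; rewrite hm (negbTE (hd _ fi)) add0n.
  by apply: map_f; exact: ht.
- exists (map double t ++ map (fun x => x.*2.+1) t).
    rewrite size_cat !size_map addnn -mul2n.
    have -> : (f k - f i = (f k - f i.+1).+1)%N.
      by have := ik ltac:(lia); lia.
    by rewrite expnS leq_mul2l.
  move=> m hd mq; rewrite hm mem_cat; case: odd => /=.
    by apply/orP; right; apply: map_f; exact: ht.
  by rewrite add0n map_f // ht.
Qed.

(** When position [L] is free, the numbers below [2 ^ L] are joined by their translates by
    [2 ^ L]. *)
Lemma digits_at_enum (f : nat -> nat) (L : nat) : unit_steps f ->
  exists s : seq nat, [/\ uniq s, size s = (2 ^ (f L - f 0))%N &
    forall m, m \in s -> digits_at f m /\ (m < 2 ^ L)%N].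
Proof.
move=> hf; elim: L => [|L [s [us ss hs]]].
  exists [:: 0%N]; split=> //; first by rewrite subnn.
  by move=> m; rewrite inE => /eqP ->; split=> // j _; rewrite div0n.
case: (hf L) => fL.
  exists s; split=> //; first by rewrite fL.
  by move=> m /hs[h1 h2]; split=> //; rewrite expnS; lia.
exists (s ++ map (addn (2 ^ L)) s); split.
- rewrite cat_uniq us map_inj_uniq ?us ?andbT /=; last exact: addnI.
  apply/hasPn => x /mapP[y ys ->]; apply/negP => /hs[_].
  by rewrite ltnNge leq_addr.
- rewrite size_cat size_map ss addnn -mul2n -expnS fL subSn //.
  exact: unit_steps_le.
- move=> m; rewrite mem_cat => /orP[/hs[h1 h2]|/mapP[y /hs[h1 h2] ->]].
    by split=> //; rewrite expnS; lia.
  split; last by rewrite expnS; lia.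
  move=> j fj; have [jL|Lj|jL] := ltngtP j L; last by move: fj; rewrite jL; lia.
    have -> : (2 ^ L = 2 ^ (L - j) * 2 ^ j)%N by rewrite -expnD subnK // ltnW.
    rewrite divnMDl ?expn_gt0 // oddD (negbTE (h1 _ fj)) addbF oddX /= orbF.
    by rewrite subn_eq0 -ltnNge.
  rewrite divn_small //.
  have: (2 ^ L.+1 <= 2 ^ j)%N by rewrite leq_exp2l.
  by rewrite expnS; lia.
Qed.

(** Reading the lists by [nth] with a default pads them all to length [K]. *)
Lemma product_enum (d K : nat) (t : 'I_d -> seq nat) :
    (forall i, size (t i) <= K)%N ->
  exists2 s : seq {ffun 'I_d -> nat}, size s = (K ^ d)%N &
    forall z : {ffun 'I_d -> nat}, (forall i, z i \in t i) -> z \in s.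
Proof.
move=> ht.
exists [seq [ffun i => nth 0%N (t i) (g i)] | g : {ffun 'I_d -> 'I_K}].
  by rewrite size_map -cardT card_ffun !card_ord.
move=> z hz; have hi i : (index (z i) (t i) < K)%N.
  by rewrite (leq_trans _ (ht i)) // index_mem.
apply/mapP; exists [ffun i => Ordinal (hi i)]; first by rewrite mem_enum.
by apply/ffunP => i; rewrite !ffunE /= nth_index.
Qed.

(** * Euclidean norm and coverings given by lists *)

Lemma coord_le_enorm (R : realType) (d : nat) (x : 'rV[R]_d) (i : 'I_d) :
  `|x ord0 i| <= enorm x.
Proof.
rewrite -sqrtr_sqr ler_wsqrtr // (bigD1 i) //= lerDl.
by apply: sumr_ge0 => j _; exact: sqr_ge0.
Qed.

Lemma enorm_le (R : realType) (d : nat) (x : 'rV[R]_d) (e : R) : 0 <= e ->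
  (forall i, `|x ord0 i| <= e) -> enorm x <= d%:R * e.
Proof.
move=> e0 hx; have de : 0 <= d%:R * e by rewrite mulr_ge0.
rewrite -(ger0_norm de) -sqrtr_sqr ler_wsqrtr // exprMn.
apply: (@le_trans _ _ (d%:R * e ^+ 2)).
  have -> : d%:R * e ^+ 2 = \sum_(i < d) e ^+ 2.
    by rewrite sumr_const card_ord mulr_natl.
  apply: ler_sum => i _; rewrite -real_normK ?num_real //.
  by rewrite lerXn2r ?nnegrE.
rewrite ler_wpM2r ?sqr_ge0 // -natrX ler_nat.
by case: d {x hx de} => // d; rewrite expnS expn1 leq_pmulr.
Qed.

Lemma covering_number_le_size (R : realType) (d : nat) (delta : R)
    (E : set 'rV[R]_d) (s : seq 'rV[R]_d) :
  (forall y, E y -> exists2 c, c \in s & eball c delta y) ->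
  (covering_number delta E <= (size s)%:R%:E)%E.
Proof.
move=> hs; apply: ereal_inf_lbound; exists (size s) => //=.
exists (fun i => nth 0 s i) => y /hs[c cs hc].
by exists (Ordinal (etrans (index_mem c s) cs)) => //=; rewrite nth_index.
Qed.

(** * Digit sets in [R^d]: covering and packing bounds *)

Definition grid_point (R : realType) (d B : nat) (z : {ffun 'I_d -> nat}) :
    'rV[R]_d := \row_i ((z i)%:R / 2 ^+ B).

(** [B] fixes the grid spacing [2 ^- B] and [L] the number of digits used, so the coordinates stay
    below [2 ^ (L - B)]. *)
Definition digit_set (R : realType) (d : nat) (f : nat -> nat) (B L : nat) :
    set 'rV[R]_d :=
  [set x | exists m : {ffun 'I_d -> nat},
    (forall i, digits_at f (m i) /\ (m i < 2 ^ L)%N) /\ x = grid_point R B m].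

Lemma digit_set_subset_points (R : realType) (d : nat) (f : nat -> nat)
    (B L : nat) :
  exists2 s : seq 'rV[R]_d, size s = ((2 ^ L) ^ d)%N &
    forall y, digit_set f B L y -> y \in s.
Proof.
have [|s ss hs] := @product_enum d (2 ^ L) (fun _ => iota 0 (2 ^ L)).
  by move=> _; rewrite size_iota.
exists (map (@grid_point R d B) s); first by rewrite size_map.
move=> _ [m [hm ->]]; apply: map_f; apply: hs => i.
by rewrite mem_iota /= add0n (hm i).2.
Qed.

Lemma digit_set_enorm (R : realType) (d : nat) (f : nat -> nat) (B L : nat)
    (y : 'rV[R]_d) :
  digit_set f B L y -> enorm y <= d%:R * ((2 ^+ L - 1) / 2 ^+ B).
Proof.
move=> [m [hm ->]]; apply: enorm_le => [|i].
  by rewrite divr_ge0 ?exprn_ge0 // subr_ge0 exprn_ege1 // ler1n.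
rewrite mxE ger0_norm; last by rewrite divr_ge0 ?exprn_ge0.
rewrite ler_pM2r ?invr_gt0 ?exprn_gt0 // lerBrDr natr1 -natrX ler_nat.
exact: (hm i).2.
Qed.

(** The window is that of the integer part of a number at distance less than 1 from [y]. For
    negative [y] both [z] and [Num.truncn y] are 0. *)
Lemma near_truncn (R : realType) (y : R) (z : nat) :
  y - 2 < z%:R -> z%:R < y + 1 ->
  z \in [:: (Num.truncn y).-1; Num.truncn y; (Num.truncn y).+1].
Proof.
move=> h1 h2; have [y0|y0] := leP 0 y.
  have /andP[q1 q2] := truncn_itv y0; set q := Num.truncn y in q1 q2 *.
  have : (z < q.+2)%N.
    by rewrite -(ltr_nat R); move: q2; rewrite -[q.+2]addn2 -addn1 !natrD; lra.
  have : (q < z + 2)%N by rewrite -(ltr_nat R) natrD; lra.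
  by rewrite !inE; lia.
have : (z < 1)%N by rewrite -(ltr_nat R); lra.
have -> : Num.truncn y = 0%N.
  apply/eqP; rewrite -leqn0 truncn_le_nat; lra.
by rewrite !inE; lia.
Qed.

(** After rescaling by [2 ^ (B - k)] the interval has radius at most 1, so it meets at most three
    dyadic blocks; each contributes [2 ^ (f k - f j)] prefixes. If [L < k], all of the [m] lie in
    the single block below [2 ^ L]. *)
Lemma digit_interval_cells (R : realType) (f : nat -> nat) (B L j k : nat)
    (x delta : R) : unit_steps f -> delta * 2 ^+ B <= 2 ^+ k ->
  exists2 t : seq nat, (size t <= 3 * 2 ^ (f (minn k L) - f j))%N &
    forall m, digits_at f m -> (m < 2 ^ L)%N ->
      `|m%:R / 2 ^+ B - x| < delta -> (m %/ 2 ^ j)%N \in t.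
Proof.
move=> hf hd; have p n : 0 < 2 ^+ n :> R by exact: exprn_gt0.
have [kL|Lk] := leqP k L; last first.
  have [t st ht] := digit_prefixes j L 0 hf.
  exists t => [|m hm mL _]; first lia.
  by apply: ht => //; rewrite divn_small.
set y := x * 2 ^+ B / 2 ^+ k; set q := Num.truncn y.
have [t1 s1 h1] := digit_prefixes j k q.-1 hf.
have [t2 s2 h2] := digit_prefixes j k q hf.
have [t3 s3 h3] := digit_prefixes j k q.+1 hf.
exists (t1 ++ t2 ++ t3) => [|m hm mL]; first by rewrite !size_cat; lia.
rewrite ltr_norml => /andP[x1 x2].
have e : (m%:R / 2 ^+ B - x) * (2 ^+ B / 2 ^+ k) = m%:R / 2 ^+ k - y.
  by rewrite /y; field; rewrite !gt_eqF ?p.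
have hb : delta * (2 ^+ B / 2 ^+ k) <= 1.
  by rewrite mulrA ler_pdivrMr // mul1r.
have pp : 0 < 2 ^+ B / 2 ^+ k :> R by rewrite divr_gt0.
have a1 : m%:R / 2 ^+ k < y + 1.
  have : (m%:R / 2 ^+ B - x) * (2 ^+ B / 2 ^+ k) < delta * (2 ^+ B / 2 ^+ k).
    by rewrite ltr_pM2r.
  rewrite e; lra.
have a2 : y - 1 < m%:R / 2 ^+ k.
  have : - delta * (2 ^+ B / 2 ^+ k) < (m%:R / 2 ^+ B - x) * (2 ^+ B / 2 ^+ k).
    by rewrite ltr_pM2r.
  rewrite e; lra.
have b1 : (m %/ 2 ^ k)%N%:R <= m%:R / 2 ^+ k :> R.
  by rewrite ler_pdivlMr // -natrX -natrM ler_nat leq_trunc_div.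
have b2 : m%:R / 2 ^+ k < (m %/ 2 ^ k)%N%:R + 1 :> R.
  rewrite ltr_pdivrMr // natr1 -natrX -natrM ltr_nat.
  by rewrite ltn_ceil // expn_gt0.
have : (m %/ 2 ^ k)%N \in [:: q.-1; q; q.+1].
  by apply: near_truncn; lra.
rewrite !inE !mem_cat => /or3P[]/eqP mq.
- by rewrite h1.
- by rewrite h2 ?orbT.
- by rewrite h3 ?orbT.
Qed.

(** The centres are the points with the digits below position [j] erased, which moves a point by
    less than [rho]. *)
Lemma digit_set_ball_cover (R : realType) (d : nat) (f : nat -> nat)
    (B L j k : nat) (x : 'rV[R]_d) (delta rho : R) :
    unit_steps f -> delta * 2 ^+ B <= 2 ^+ k ->
    d%:R * ((2 ^+ j - 1) / 2 ^+ B) < rho ->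
  exists2 s : seq 'rV[R]_d,
    size s = ((3 * 2 ^ (f (minn k L) - f j)) ^ d)%N &
    forall y, digit_set f B L y -> eball x delta y ->
      exists2 c, c \in s & eball c rho y.
Proof.
move=> hf hd hr.
pose P i t := (size t <= 3 * 2 ^ (f (minn k L) - f j))%N /\
    forall m, digits_at f m -> (m < 2 ^ L)%N ->
      `|m%:R / 2 ^+ B - x ord0 i| < delta -> (m %/ 2 ^ j)%N \in t.
have /choice[t ht] : forall i, exists t, P i t.
  move=> i; have [t st ht] := digit_interval_cells L j (x ord0 i) hf hd.
  by exists t; split.
have [s ss hs] := product_enum (fun i => (ht i).1).
exists [seq @grid_point R d B [ffun i => (z i * 2 ^ j)%N] |
  z : {ffun 'I_d -> nat} <- s].
  by rewrite size_map.
move=> _ [m [hm ->]] hx.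
exists (@grid_point R d B [ffun i => (m i %/ 2 ^ j * 2 ^ j)%N]).
  apply/mapP; exists [ffun i => (m i %/ 2 ^ j)%N].
    apply: hs => i; rewrite ffunE; apply: (ht i).2; try exact: (hm i).1.
      exact: (hm i).2.
    apply: le_lt_trans hx.
    by have := coord_le_enorm (grid_point R B m - x) i; rewrite !mxE.
  by congr grid_point; apply/ffunP => i; rewrite !ffunE.
apply: le_lt_trans hr; apply: enorm_le => [|i].
  by rewrite divr_ge0 ?exprn_ge0 // subr_ge0 exprn_ege1 // ler1n.
rewrite !mxE !ffunE {1}(divn_eq (m i) (2 ^ j)) natrD mulrDl addrAC subrr add0r.
rewrite ger0_norm ?divr_ge0 ?exprn_ge0 // ler_pM2r ?invr_gt0 ?exprn_gt0 //.
rewrite lerBrDr natr1 -natrX ler_nat.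
by rewrite ltn_mod expn_gt0.
Qed.

Lemma digit_set_coverable_ge (R : realType) (d : nat) (f : nat -> nat)
    (B L N : nat) (rho : R) (E : set 'rV[R]_d) :
    unit_steps f -> 2 * rho * 2 ^+ B <= 1 ->
    (forall y, digit_set f B L y -> E y) -> coverable rho E N ->
  ((2 ^ (f L - f 0)) ^ d <= N)%N.
Proof.
move=> hf hr hE [c hc].
have [s [us <- hs]] := digits_at_enum L hf.
pose pt (g : {ffun 'I_d -> 'I_(size s)}) :=
  @grid_point R d B [ffun i => nth 0%N s (g i)].
have /choice[h hh] : forall g, exists i : 'I_N, eball (c i) rho (pt g).
  move=> g; have /hE/hc[i _ hi] : digit_set f B L (pt g); last by exists i.
  exists [ffun i => nth 0%N s (g i)]; split => // i; rewrite ffunE.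
  by apply: hs; exact: mem_nth.
suff hi : injective h by have := leq_card _ hi; rewrite card_ffun !card_ord.
(* Grid points are [2 rho] apart in each coordinate. *)
move=> g g' e; apply/ffunP => i; apply/val_inj/eqP.
rewrite -(nth_uniq 0%N (ltn_ord (g i)) (ltn_ord (g' i)) us); apply/eqP.
have /(le_lt_trans (coord_le_enorm _ i)) := hh g.
have /(le_lt_trans (coord_le_enorm _ i)) := hh g'.
rewrite -e !mxE !ffunE; set a := nth _ _ _; set b := nth _ _ _.
set w := c _ _ _; rewrite !ltr_norml => /andP[b1 b2] /andP[a1 a2].
have p : 0 < 2 ^+ B :> R by exact: exprn_gt0.
have r : 2 * rho <= 1 / 2 ^+ B by rewrite ler_pdivlMr.
have l (u v : nat) :
    u%:R / 2 ^+ B < v%:R / 2 ^+ B + 1 / 2 ^+ B :> R -> (u <= v)%N.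
  by rewrite -mulrDl ltr_pM2r ?invr_gt0 // natr1 ltr_nat.
by apply/eqP; rewrite eqn_leq !l //; lra.
Qed.

(** * Exponents of the Assouad spectrum and necessity *)

Definition spectrum_exponent (R : realType) (d : nat) (theta : R)
    (F : set 'rV[R]_d) (alpha : R) : Prop :=
  exists C : R, 0 < C /\
    forall delta : R, 0 < delta <= 1 -> forall x : 'rV[R]_d, F x ->
      (covering_number (delta `^ theta^-1) (F `&` eball x delta)%classic <=
        (C * (delta / delta `^ theta^-1) `^ alpha)%:E)%E.

Lemma assouad_spectrum_le (R : realType) (d : nat) (theta : R)
    (F : set 'rV[R]_d) (alpha : R) :
  spectrum_exponent theta F alpha -> (assouad_spectrum theta F <= alpha%:E)%E.
Proof. by move=> h; apply: ereal_inf_lbound; exists alpha. Qed.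

Lemma le_assouad_spectrum (R : realType) (d : nat) (theta : R)
    (F : set 'rV[R]_d) (a : R) :
  (forall alpha, spectrum_exponent theta F alpha -> a <= alpha) ->
  (a%:E <= assouad_spectrum theta F)%E.
Proof.
by move=> h; apply: le_ereal_inf_tmp => _ [alpha ha <-]; rewrite lee_fin h.
Qed.

Lemma le_covering_number (R : realType) (d : nat) (delta : R)
    (E E' : set 'rV[R]_d) : (E `<=` E')%classic ->
  (covering_number delta E <= covering_number delta E')%E.
Proof.
move=> h; apply: le_ereal_inf_tmp => _ [n [c hc] <-].
apply: ereal_inf_lbound; exists n => //; exists c.
exact: subset_trans h hc.
Qed.

Lemma pow2D (R : realType) (a b : R) : 2 `^ (a + b) = 2 `^ a * 2 `^ b.
Proof. by rewrite powRD // pnatr_eq0 implybT. Qed.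

Lemma le_pow2 (R : realType) (a b : R) : a <= b -> 2 `^ a <= 2 `^ b.
Proof. by apply: ler_powR; rewrite ler1n. Qed.

Lemma pow2_gt0 (R : realType) (a : R) : 0 < 2 `^ a.
Proof. exact: powR_gt0. Qed.

Lemma pow2_ge1 (R : realType) (a : R) : 0 <= a -> 1 <= 2 `^ a.
Proof. by move=> /le_pow2; rewrite powRr0. Qed.

Lemma pow2_natr (R : realType) (n : nat) : 2 `^ n%:R = 2 ^+ n :> R.
Proof. exact: powR_mulrn. Qed.

(** Logarithmic coordinate: with the small radius written [2 ^ (- v)], all comparisons of scales
    become linear in [v]. *)
Lemma scale_log2 (R : realType) (t delta : R) : 0 < t -> 0 < delta <= 1 ->
  exists v, [/\ 0 <= v, delta = 2 `^ (- (t * v)) & delta `^ t^-1 = 2 `^ (- v)].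
Proof.
move=> t0 /andP[d0 d1]; have l2 : 0 < ln 2 :> R by rewrite ln_gt0 // ltr1n.
exists (- ln delta / (t * ln 2)).
have e : delta = 2 `^ (- (t * (- ln delta / (t * ln 2)))).
  rewrite /powR pnatr_eq0 /=.
  suff -> : - (t * (- ln delta / (t * ln 2))) * ln 2 = ln delta by rewrite lnK.
  by field; rewrite !gt_eqF.
split=> //.
  by rewrite divr_ge0 ?mulr_ge0 ?(ltW t0) ?(ltW l2) // oppr_ge0 ln_le0.
rewrite {1}e -powRrM; congr powR; by field; rewrite !gt_eqF.
Qed.

(** The new exponent makes the two bounds coincide: both equal [C * 2 ^ ((1 - s) * v * alpha)]. *)
Lemma spectrum_exponent_transfer (R : realType) (d : nat) (s t : R)
    (F : set 'rV[R]_d) (alpha : R) : 0 < s -> s <= t -> t < 1 ->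
  spectrum_exponent s F alpha ->
  spectrum_exponent t F (alpha * (1 - s) / (1 - t)).
Proof.
move=> s0 st t1 [C [C0 hC]]; exists C.
split; first exact: C0.
move=> delta hd x Fx.
have [v [v0 de re]] := scale_log2 (lt_le_trans s0 st) hd.
have hd' : 0 < 2 `^ (- (s * v)) <= (1 : R).
  rewrite pow2_gt0 -[leRHS](powRr0 2) le_pow2 // oppr_le0 mulr_ge0 //.
  exact: ltW.
have r' : (2 `^ (- (s * v))) `^ s^-1 = 2 `^ (- v).
  by rewrite -powRrM; congr powR; field; rewrite gt_eqF.
have := hC _ hd' x Fx; rewrite r' re => h; apply: (le_trans _ (le_trans h _)).
  apply: le_covering_number => y [Fy hy]; split=> //.
  apply: lt_le_trans hy _; rewrite de le_pow2 // lerN2 ler_wpM2r //.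
rewrite lee_fin ler_wpM2l //; first exact: ltW.
rewrite de -!powRN -!pow2D -!powRrM le_eqVlt; apply/orP; left; apply/eqP.
by congr powR; field; rewrite subr_eq0 gt_eqF.
Qed.

Lemma spectrum_decreasing (R : realType) (d : nat) (s t a b : R)
    (F : set 'rV[R]_d) : 0 < s -> s <= t -> t < 1 ->
    assouad_spectrum s F = a%:E -> assouad_spectrum t F = b%:E ->
  (1 - t) * b <= (1 - s) * a.
Proof.
move=> s0 st t1 ea eb; have t1' : 0 < 1 - t by rewrite subr_gt0.
have s1' : 0 < 1 - s by lra.
rewrite -ler_pdivrMl // -lee_fin -ea.
apply: le_assouad_spectrum => alpha /(spectrum_exponent_transfer s0 st t1).
move/assouad_spectrum_le; rewrite eb lee_fin => h.
rewrite ler_pdivrMl //; move: h; rewrite ler_pdivlMr //; lra.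
Qed.

(** * Evenly spread digits and the choice of scales *)

Lemma unit_steps_truncn (R : realType) (sigma : R) : 0 <= sigma <= 1 ->
  unit_steps (fun j => Num.truncn (sigma * j%:R)).
Proof.
move=> /andP[s0 s1] j.
have h1 : 0 <= sigma * j%:R by rewrite mulr_ge0.
have h2 : 0 <= sigma * j.+1%:R by rewrite mulr_ge0.
have /andP[a1 a2] := truncn_itv h1; have /andP[b1 b2] := truncn_itv h2.
set u := Num.truncn _ in a1 a2 *; set w := Num.truncn _ in b1 b2 *.
move: b1 b2 a2; rewrite -[j.+1]addn1 -[w.+1]addn1 -[u.+1]addn1 !natrD => b1 b2 a2.
have : (u < w + 1)%N by rewrite -(ltr_nat R) natrD; lra.
have : (w < u + 2)%N by rewrite -(ltr_nat R) natrD; lra.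
lia.
Qed.

Lemma truncn_subn_le (R : realType) (sigma : R) (j k : nat) : 0 <= sigma ->
  (Num.truncn (sigma * k%:R) - Num.truncn (sigma * j%:R))%N%:R <=
    sigma * (k - j)%N%:R + 1.
Proof.
move=> s0; have h1 : 0 <= sigma * j%:R by rewrite mulr_ge0.
have h2 : 0 <= sigma * k%:R by rewrite mulr_ge0.
have h3 : 0 <= sigma * (k - j)%N%:R by rewrite mulr_ge0.
have [kj|jk] := leqP k j.
  have : (Num.truncn (sigma * k%:R) <= Num.truncn (sigma * j%:R))%N.
    by apply: le_truncn; rewrite ler_wpM2l // ler_nat.
  by rewrite -subn_eq0 => /eqP ->; lra.
have le : (Num.truncn (sigma * j%:R) <= Num.truncn (sigma * k%:R))%N.
  by apply: le_truncn; rewrite ler_wpM2l // ler_nat ltnW.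
have /andP[a1 a2] := truncn_itv h1; have /andP[b1 b2] := truncn_itv h2.
move: a2; rewrite !natrB ?(ltnW jk) // -addn1 natrD; lra.
Qed.

(* [W n] bounds the number of points of the pieces of index [< n], and [B n] is
   chosen so large that this number is negligible at the scales of piece [n]. *)
Lemma scales_exist (R : realType) (d : nat) (th : nat -> R) (K : nat -> nat) :
    (forall n, 0 < th n) ->
  exists B W : nat -> nat,
    [/\ forall n, (0 < W n)%N,
        forall n, (W n + 2 ^ (d.+1 * B n) <= W n.+1)%N,
        forall n, (n.+1 * W n <= Num.truncn (th n * (B n).+1%:R))%N &
        forall n, (K n <= B n)%N].
Proof.
move=> th0.
(* Division by [th n] makes [th n * (b n w).+1] exceed [n.+1 * w]; the summand [K n] lets a
   recurring parameter reach arbitrarily fine scales. *)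
pose b n w := (Num.truncn ((n.+1 * w)%N%:R / th n) + K n)%N.
(* The exponent has [d.+1] rather than [d] so that [W n.+1] exceeds [B n] even in dimension 0. *)
pose W := fix W n :=
  if n is m.+1 then (W m + 2 ^ (d.+1 * b m (W m)))%N else 1%N.
exists (fun n => b n (W n)), W; split=> // n.
- by case: n => [|n] //=; rewrite addn_gt0 expn_gt0 orbT.
- rewrite truncn_ge_nat; last by rewrite mulr_ge0 // ltW.
  rewrite mulrC -ler_pdivrMr // ltW // (lt_le_trans (truncnS_gt _)) //.
  by rewrite ler_nat ltnS leq_addr.
- exact: leq_addl.
Qed.

(** * A single piece and its covering numbers at all scales *)

Definition piece_steps (R : realType) (d : nat) (s : R) (j : nat) : nat :=
  Num.truncn (s / d%:R * j%:R).

(* The top scale [2 ^- top_digit] of a piece is slightly below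
   [2 `^ (- (th * (B + 1)))], so that the piece lies in the ball of that radius
   around [0]. *)
Definition top_digit (R : realType) (d : nat) (th : R) (B : nat) : nat :=
  (Num.truncn (th * B.+1%:R) + d.+1)%N.

(** With [r = 2 ^- B], this is the set of dimension [s] between scales about [r ^ th] and [r]. If no
    digits remain, truncated subtraction leaves only the point 0. *)
Definition piece (R : realType) (d : nat) (th s : R) (B : nat) :
    set 'rV[R]_d :=
  digit_set (piece_steps d s) B (B - top_digit d th B).

(** Density of free digits in each coordinate; in dimension 0 it is 0 by the convention for
    inverses. *)
Lemma density_bounds (R : realType) (d : nat) (s : R) :
  0 <= s <= d%:R -> 0 <= s / d%:R <= 1.
Proof.
move=> /andP[s0 sd]; rewrite divr_ge0 //=.
have [->|d0] := eqVneq d%:R (0 : R); first by rewrite invr0 mulr0 ler01.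
by rewrite ler_pdivrMr ?mul1r // lt_def d0 ler0n.
Qed.

Lemma density_mul (R : realType) (d : nat) (s : R) :
  0 <= s <= d%:R -> d%:R * (s / d%:R) = s.
Proof.
move=> /andP[s0 sd]; have [d0|d0] := eqVneq d%:R (0 : R).
  by move: sd; rewrite d0 => s0'; rewrite mul0r; apply/eqP; rewrite eq_le s0 s0'.
by rewrite mulrC divfK.
Qed.

(** The [d] additional digits in [b] absorb the factor [d], since [d <= 2 ^ d]. *)
Lemma truncation_error (R : realType) (d B b : nat) (v : R) :
  v + d%:R <= b%:R -> d%:R * ((2 ^+ (B - b) - 1) / 2 ^+ B) < 2 `^ (- v).
Proof.
move=> hb; have [bB|Bb] := leqP b B; last first.
  by rewrite (eqP (ltnW Bb : (B - b == 0)%N)) expr0 subrr mul0r mulr0 pow2_gt0.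
have hd : d%:R <= 2 `^ d%:R :> R.
  by rewrite pow2_natr -natrX ler_nat ltnW // ltn_expl.
have -> : 2 ^+ B = 2 ^+ (B - b) * 2 ^+ b :> R by rewrite -exprD subnK.
set u := 2 ^+ (B - b); have u0 : 0 < u by exact: exprn_gt0.
have b0 : 0 < 2 ^+ b :> R by exact: exprn_gt0.
have -> : d%:R * ((u - 1) / (u * 2 ^+ b)) = d%:R * (1 - u^-1) / 2 ^+ b.
  by field; rewrite !gt_eqF.
have hv : 2 `^ d%:R <= 2 `^ (- v) * 2 ^+ b.
  by rewrite -pow2_natr -pow2D le_pow2 //; lra.
have ui : 0 < u^-1 by rewrite invr_gt0.
rewrite ltr_pdivrMr //; apply: lt_le_trans hv.
have [->|d0] := posnP d; first by rewrite mul0r powRr0.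
apply: lt_le_trans hd; rewrite gtr_pMr ?ltr0n //; lra.
Qed.

(** Three blocks per coordinate give [3 ^ d]; the exponent adds [d * (d + 2)] from [piece_log_count]
    and [d] from rounding the digit counts. *)
Definition piece_const (R : realType) (d : nat) : R :=
  3 ^+ d * 2 ^+ (d * (d + 3)).

(** Positivity of [X] turns the truncated subtractions into linear bounds, even when [B < b]. *)
Lemma digit_window (B a c b : nat) :
  let X := (minn (B - a) (B - c) - (B - b))%N in (0 < X)%N ->
  [/\ X + a <= b, X + c <= b & X + c <= B]%N.
Proof. by move=> /= h; split; lia. Qed.

(** The two monotonicity conditions enter here. The digits that count lie below the ball's scale and
    the piece's top scale, and above the resolution [2 ^ (- v)]. *)
Lemma piece_log_count (R : realType) (d : nat) (th t s p v : R) (B : nat) :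
    0 <= s <= d%:R -> 0 < th < 1 -> 0 < t < 1 -> 0 <= p -> 0 <= v ->
    (th <= t -> s <= p) -> (t <= th -> (1 - th) * s <= (1 - t) * p) ->
  s * (minn (B - Num.truncn (t * v)) (B - top_digit d th B) -
         (B - (Num.truncn v + d.+1)))%N%:R <=
    (1 - t) * p * v + d%:R * (d%:R + 2).
Proof.
move=> /andP[s0 sd] /andP[th0 th1] /andP[t0 t1] p0 v0 h1 h2.
have tv0 : 0 <= t * v by rewrite mulr_ge0 // ltW.
have tB0 : 0 <= th * B.+1%:R by rewrite mulr_ge0 // ltW.
have d0 : 0 <= d%:R :> R by [].
have hd : 0 <= d%:R * (d%:R + 2) :> R by rewrite mulr_ge0 // addr_ge0.
have hp : 0 <= (1 - t) * p * v by rewrite !mulr_ge0 // subr_ge0 ltW.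
rewrite /top_digit.
have /andP[_ a2] := truncn_itv tv0; have /andP[b1 _] := truncn_itv v0.
have /andP[_ c2] := truncn_itv tB0.
set a := Num.truncn (t * v) in a2 *; set b := Num.truncn v in b1 *.
set c := Num.truncn (th * _) in c2 *.
set X := (_ - (_ - _))%N; have [->|X0] := posnP X; first by rewrite mulr0; lra.
have [x1 x2 x3] := digit_window X0; rewrite -/X in x1 x2 x3.
move: {X0} X x1 x2 x3 => X; rewrite -!(ler_nat R) !natrD => x1 x2 x3.
have XR : 0 <= X%:R :> R by [].
move: c2 a2 x1 x2 x3; rewrite -[c.+1]addn1 -[a.+1]addn1 -[d.+1]addn1.
rewrite -[B.+1]addn1 !natrD => c2 a2 x1 x2 x3.
have dt := ler_wpM2l s0.
(* For [th <= t] the ball leaves about [(1 - t) * v] digits, and [s <= p] suffices. *)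
have [ht|ht] := leP th t.
  have e : X%:R <= (1 - t) * v + d%:R + 2 by lra.
  have e1 := dt _ _ e.
  have e2 : s * ((1 - t) * v) <= p * ((1 - t) * v).
    by rewrite ler_wpM2r ?h1 // mulr_ge0 // subr_ge0 ltW.
  have e3 : s * (d%:R + 2) <= d%:R * (d%:R + 2) by rewrite ler_wpM2r // addr_ge0.
  lra.
(* The piece has at most [(1 - th) * B] digits, enough if [B] is at most [v + d + 1]. Beyond that
   only about [v - th * B] are resolved, which decreases in [B]. *)
have e : X%:R <= (1 - th) * (v + d%:R + 1).
  have [hB|hB] := leP B%:R (v + d%:R + 1).
    have : (1 - th) * B%:R <= (1 - th) * (v + d%:R + 1).
      by rewrite ler_wpM2l // subr_ge0 ltW.
    lra.
  have : th * (v + d%:R + 1) <= th * B%:R by rewrite ler_wpM2l // ltW.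
  lra.
have e1 := dt _ _ e.
have e2 : (1 - th) * s * v <= (1 - t) * p * v by rewrite ler_wpM2r // h2 // ltW.
have e3 : (1 - th) * s <= d%:R.
  by apply: le_trans sd; rewrite ler_piMl //; lra.
have e4 : (1 - th) * s * (d%:R + 1) <= d%:R * (d%:R + 1).
  by rewrite ler_wpM2r // addr_ge0.
lra.
Qed.

Lemma piece_cover (R : realType) (d : nat) (th t s p v : R) (B : nat)
    (x : 'rV[R]_d) :
    0 <= s <= d%:R -> 0 < th < 1 -> 0 < t < 1 -> 0 <= p -> 0 <= v ->
    (th <= t -> s <= p) -> (t <= th -> (1 - th) * s <= (1 - t) * p) ->
  exists2 q : seq 'rV[R]_d,
    (size q)%:R <= piece_const R d * 2 `^ ((1 - t) * p * v) &
    forall y, piece th s B y -> eball x (2 `^ (- (t * v))) y ->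
      exists2 c, c \in q & eball c (2 `^ (- v)) y.
Proof.
move=> hs hth ht p0 v0 h1 h2.
have us : unit_steps (piece_steps d s).
  exact: unit_steps_truncn (density_bounds hs).
(* The ball leaves free the digits after the first [a]; keeping [b] digits gives accuracy
   [2 ^ (- v)], with [d.+1] for rounding and [truncation_error]. *)
set a := Num.truncn (t * v); set b := (Num.truncn v + d.+1)%N.
have tv0 : 0 <= t * v by rewrite mulr_ge0 //; case/andP: ht => /ltW.
have hk : 2 `^ (- (t * v)) * 2 ^+ B <= 2 ^+ (B - a) :> R.
  rewrite -!pow2_natr -pow2D le_pow2 //.
  have /andP[a1 _] := truncn_itv tv0; rewrite -/a in a1.
  have : (B <= a + (B - a))%N by rewrite -leq_subLR.
  by rewrite -(ler_nat R) natrD; lra.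
have hj : d%:R * ((2 ^+ (B - b) - 1) / 2 ^+ B) < 2 `^ (- v) :> R.
  apply: truncation_error; have := truncnS_gt v.
  by rewrite /b -addn1 -[d.+1]addn1 !natrD; lra.
have [q sq hq] := digit_set_ball_cover (B - top_digit d th B) x us hk hj.
exists q; last exact: hq.
have := @piece_log_count R d th t s p v B hs hth ht p0 v0 h1 h2.
rewrite sq -/a -/b; set k := minn _ _; set j := (B - b)%N => hc.
have sig0 : 0 <= s / d%:R by case/andP: (density_bounds hs).
have := truncn_subn_le j k sig0; rewrite -!/(piece_steps d s _).
set e := (_ - _)%N => he.
rewrite natrX natrM natrX exprMn /piece_const -mulrA ler_pM2l ?exprn_gt0 //.
rewrite -exprM -!pow2_natr -pow2D le_pow2 //.
have := ler_wpM2l (ler0n R d) he; rewrite mulrDr mulrA density_mul //.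
rewrite !natrM natrD; lra.
Qed.

(** * The union of the pieces: upper bound for the spectrum *)

Lemma enorm0 (R : realType) (d : nat) : enorm (0 : 'rV[R]_d) = 0.
Proof.
by rewrite /enorm big1 ?sqrtr0 // => i _; rewrite mxE expr0n.
Qed.

Lemma pieces_enum (R : realType) (d : nat) (th s : nat -> R) (B W : nat -> nat)
    (n : nat) : (forall n, (W n + 2 ^ (d.+1 * B n) <= W n.+1)%N) ->
  exists2 q : seq 'rV[R]_d, (size q <= W n)%N &
    forall m y, (m < n)%N -> piece (th m) (s m) (B m) y -> y \in q.
Proof.
move=> hW; elim: n => [|n [q sq hq]]; first by exists [::].
have [q' sq' hq'] := @digit_set_subset_points R d (piece_steps d (s n)) (B n)
  (B n - top_digit d (th n) (B n)).
exists (q ++ q').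
  rewrite size_cat sq'; apply: leq_trans (hW n); apply: leq_add => //.
  by rewrite -expnM leq_exp2l // mulnC leq_mul // leq_subr.
move=> m y; rewrite ltnS leq_eqVlt mem_cat => /orP[/eqP -> /hq' ->|mn hy].
  by rewrite orbT.
by rewrite (hq _ _ mn hy).
Qed.

Lemma nondecreasing_nat (u : nat -> nat) : (forall n, u n <= u n.+1)%N ->
  forall m n, (m <= n)%N -> (u m <= u n)%N.
Proof.
move=> h m n /subnK <-; elim: (n - m)%N => // k IH.
by rewrite addSn (leq_trans IH).
Qed.

Lemma piece_near0 (R : realType) (d : nat) (th s v : R) (B : nat)
    (y : 'rV[R]_d) : v <= (Num.truncn (th * B.+1%:R)).+1%:R ->
  piece th s B y -> enorm y < 2 `^ (- v).
Proof.
move=> hv /digit_set_enorm /le_lt_trans; apply; apply: truncation_error.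
by rewrite /top_digit addnS -addSn natrD lerD2r.
Qed.

Lemma pieces_exponent (R : realType) (d : nat) (phi : R -> R) (th : nat -> R)
    (B W : nat -> nat) (t eps : R) :
    (forall t, 0 < t < 1 -> 0 <= phi t <= d%:R) ->
    (forall s t, 0 < s < 1 -> 0 < t < 1 -> s <= t -> phi s <= phi t) ->
    (forall s t, 0 < s < 1 -> 0 < t < 1 -> s <= t ->
      (1 - t) * phi t <= (1 - s) * phi s) ->
    (forall n, 0 < th n < 1) ->
    (forall n, (0 < W n)%N) ->
    (forall n, (W n + 2 ^ (d.+1 * B n) <= W n.+1)%N) ->
    (forall n, (n.+1 * W n <= Num.truncn (th n * (B n).+1%:R))%N) ->
    0 < t < 1 -> 0 < eps ->
  spectrum_exponent t
    [set y : 'rV[R]_d | exists n, piece (th n) (phi (th n)) (B n) y]%classic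
    (phi t + eps).
Proof.
move=> phi_range phi_incr phi_decr hth W0 hW hB ht eps0.
have /andP[t0 t1] := ht.
have /andP[p0 _] := phi_range _ ht.
pose a n := Num.truncn (th n * (B n).+1%:R).
have hBW n : (B n < W n.+1)%N.
  apply: leq_trans (hW n); rewrite (leq_trans (ltn_expl (B n) (ltnSn 1))) //.
  by rewrite (leq_trans _ (leq_addl _ _)) // leq_exp2l // leq_pmull.
have aB n : (a n <= B n)%N.
  have /andP[th0 th1] := hth n; rewrite truncn_le_nat.
  by rewrite gtr_pMl ?ltr0Sn.
have Wa n : (W n <= a n)%N by rewrite (leq_trans _ (hB n)) // leq_pmull.
have a_incr : forall m n, (m <= n)%N -> (a m <= a n)%N.
  apply: nondecreasing_nat => n; rewrite (leq_trans (aB n)) //.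
  exact: leq_trans (ltnW (hBW n)) (Wa _).
have W_incr : forall m n, (m <= n)%N -> (W m <= W n)%N.
  by apply: nondecreasing_nat => n; apply: leq_trans (hW n); exact: leq_addr.
have psi0 : 0 <= (1 - t) * phi t by rewrite mulr_ge0 // subr_ge0 ltW.
have te0 : 0 < (1 - t) * eps by rewrite mulr_gt0 // subr_gt0.
(* Beyond [n0] one has [1 <= (1 - t) * eps * n.+1]; earlier indices are paid for by the constant
   [W n0]. *)
pose n0 := Num.truncn ((1 - t) * eps)^-1.
have C0 : 0 <= piece_const R d by rewrite mulr_ge0 ?exprn_ge0.
(* The summands pay for the ball around 0, the coarser pieces and the piece at the current scale. *)
exists (1 + (W n0)%:R + piece_const R d); split.
  by rewrite ltr_wpDr // ltr_wpDr // ltr01.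
move=> delta hd x _; have [v [v0 de re]] := scale_log2 t0 hd.
set Y := 2 `^ ((1 - t) * phi t * v + (1 - t) * eps * v).
have -> : (delta / delta `^ t^-1) `^ (phi t + eps) = Y.
  by rewrite re de -powRN -pow2D -powRrM; congr powR; ring.
rewrite re.
have Y1 : 1 <= Y.
  by apply: pow2_ge1; rewrite addr_ge0 // mulr_ge0 // ltW.
have cover_tail n m (y : 'rV[R]_d) : v <= (a n)%:R -> (n <= m)%N ->
    piece (th m) (phi (th m)) (B m) y -> eball 0 (2 `^ (- v)) y.
  move=> vn nm; rewrite /eball /= subr0; apply: piece_near0.
  rewrite (le_trans vn) // ler_nat; exact: leqW (a_incr _ _ nm).
have exk : exists k, v <= (a k)%:R.
  exists (Num.truncn v).+1; rewrite (le_trans (ltW (truncnS_gt v))) // ler_nat.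
  rewrite (leq_trans _ (hB _)) // (leq_trans (leqnSn _)) //.
  by rewrite leq_pmulr.
(* From index [k] on, pieces fit in the ball around 0; piece [k - 1] is covered by [piece_cover],
   and points of earlier pieces are their own centres. *)
case: (ex_minnP exk) => k hk kmin.
have kmin' m : (m < k)%N -> (a m)%:R < v.
  by move=> mk; rewrite ltNge; apply/negP => /kmin; rewrite leqNgt mk.
have [k0|k0] := posnP k.
  apply: (@le_trans _ _ (1%:R%:E)); last first.
    rewrite lee_fin -[leLHS]mulr1 ler_pM // ler_wpDr // ler_wpDr //.
  apply: (@covering_number_le_size _ _ _ _ [:: 0]) => y [[m hm] _].
  exists 0; first by rewrite inE.
  by apply: (cover_tail k) hm => //; rewrite k0.
pose n := k.-1; have kn : k = n.+1 by rewrite prednK.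
have an : (a n)%:R < v by apply: kmin'; rewrite kn.
have [q sq hq] := pieces_enum th (phi \o th) n hW.
have [|u su hu] := @piece_cover R d (th n) t (phi (th n)) (phi t) v (B n) x
    (phi_range _ (hth n)) (hth n) ht p0 v0 (phi_incr _ _ (hth n) ht).
  by move=> htn; apply: phi_decr.
apply: (@le_trans _ _ (size (0 :: q ++ u))%:R%:E).
  apply: covering_number_le_size => y [[m hm] hy].
  have [mn|nm] := ltnP m n.
    exists y; first by rewrite inE mem_cat (hq _ _ mn hm) orbT.
    by rewrite /eball /= subrr enorm0.
  have [km|mk] := leqP k m.
    exists 0; first by rewrite inE eqxx.
    exact: (cover_tail k) hm.
  have mn : m = n by apply/eqP; rewrite eqn_leq nm -ltnS -kn mk.
  rewrite mn in hm; have [c cu hc] : exists2 c, c \in u & eball c (2 `^ (- v)) y.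
    by apply: hu => //; rewrite -de.
  by exists c => //; rewrite inE mem_cat cu !orbT.
rewrite lee_fin /= size_cat -addn1 !natrD.
have hWY : (W n)%:R <= (W n0)%:R * Y.
  have [nn0|n0n] := leqP n n0.
    rewrite -[leLHS]mulr1 ler_pM // ler_nat; exact: W_incr.
  apply: (@le_trans _ _ Y); last first.
    by rewrite ler_peMl ?ler1n // (le_trans _ Y1).
  (* Here [W n <= 2 ^ (W n)], and [n.+1 * W n <= a n < v] gives [W n <= (1 - t) * eps * v]. *)
  have : (W n)%:R <= 2 `^ (W n)%:R :> R.
    by rewrite pow2_natr -natrX ler_nat ltnW // ltn_expl.
  move=> /le_trans; apply; apply: le_pow2.
  apply: (@le_trans _ _ ((1 - t) * eps * v)); last first.
    by rewrite lerDr mulr_ge0.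
  have h1 : n.+1%:R * (W n)%:R <= v.
    by apply: ltW; apply: le_lt_trans an; rewrite -natrM ler_nat hB.
  have h2 : 1 <= (1 - t) * eps * n.+1%:R.
    rewrite mulrC -ler_pdivrMr // div1r (le_trans (ltW (truncnS_gt _))) //.
    by rewrite ler_nat ltnS ltnW.
  apply: (@le_trans _ _ ((1 - t) * eps * n.+1%:R * (W n)%:R)).
    by rewrite ler_peMl.
  by rewrite -mulrA ler_wpM2l // ltW.
have hu' : (size u)%:R <= piece_const R d * Y.
  apply: le_trans su _; rewrite ler_wpM2l // le_pow2 // lerDl.
  by rewrite mulr_ge0 // ltW.
have hq' : (size q)%:R <= (W n)%:R :> R by rewrite ler_nat.
rewrite !mulrDl mul1r; lra.
Qed.

(** * Lower bound at the parameters of the pieces *)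

Lemma piece_exponent_ge (R : realType) (d : nat) (F : set 'rV[R]_d)
    (th s alpha : R) : 0 <= s <= d%:R -> 0 < th < 1 ->
    (forall K, exists2 B, (K <= B)%N & forall y, piece th s B y -> F y) ->
  spectrum_exponent th F alpha -> s <= alpha.
Proof.
move=> hs /andP[th0 th1] hF [C [C0 hC]]; rewrite leNgt; apply/negP => sa.
have us : unit_steps (piece_steps d s).
  exact: unit_steps_truncn (density_bounds hs).
have sd0 : 0 <= s / d%:R by case/andP: (density_bounds hs).
have s0 : 0 <= s by case/andP: hs.
have g0 : 0 < (1 - th) * (s - alpha) by rewrite mulr_gt0 // subr_gt0.
(* The needed number of balls exceeds the allowed one by a factor of order [2 ^ (g * B)], which
   beats any constant for large [B]. *)
set g := (1 - th) * (s - alpha) in g0.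
(* Rounding losses: up to [d + 2] digits missing from [L], and one from the floor in each of the [d]
   coordinates. *)
pose D := s * (d%:R + 2) + d%:R.
pose T := Num.truncn (C * 2 `^ D).
have [B hB hp] := hF (Num.truncn (T.+1%:R / g)).
have {hB} hB : T.+1%:R <= g * B.+1%:R.
  rewrite mulrC -ler_pdivrMr // (le_trans (ltW (truncnS_gt _))) //.
  by rewrite ler_nat ltnS.
have tB0 : 0 <= th * B.+1%:R by rewrite mulr_ge0 // ltW.
(* With [B.+1] the small radius is [2 ^ (- (B + 1))], half the grid spacing, so each ball holds at
   most one grid point. *)
pose delta : R := 2 `^ (- (th * B.+1%:R)).
have hd : 0 < delta <= 1.
  by rewrite pow2_gt0 -[leRHS](powRr0 2) le_pow2 // oppr_le0.
have hr : delta `^ th^-1 = 2 `^ (- B.+1%:R).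
  by rewrite -powRrM; congr powR; field; rewrite gt_eqF.
set L := (B - top_digit d th B)%N.
have F0 : F 0.
  apply: hp; exists [ffun _ => 0%N]; split.
    by move=> i; rewrite ffunE expn_gt0; split=> // j _; rewrite div0n.
  by apply/rowP => i; rewrite !mxE ffunE mul0r.
have hE y : piece th s B y -> (F `&` eball 0 delta)%classic y.
  move=> hy; split; first exact: hp.
  rewrite /eball /= subr0; apply: piece_near0 hy; exact/ltW/truncnS_gt.
have := hC _ hd 0 F0; apply/negP; rewrite -ltNge.
apply: (@lt_le_trans _ _ (((2 ^ (piece_steps d s L)) ^ d)%N%:R%:E)); last first.
  apply: le_ereal_inf_tmp => _ [N hN <-]; rewrite lee_fin ler_nat.
  have f0 : piece_steps d s 0 = 0%N by rewrite /piece_steps mulr0 truncn0.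
  rewrite -[piece_steps d s L]subn0 -[X in (_ - X)%N]f0.
  apply: (digit_set_coverable_ge us _ hE hN).
  by rewrite hr mulrAC mulrC -exprS -pow2_natr -pow2D addNr powRr0.
rewrite lte_fin hr /delta -powRN -pow2D -powRrM -expnM natrX -pow2_natr natrM.
apply: (@lt_le_trans _ _ (2 `^ (s * L%:R - d%:R))); last first.
  apply: le_pow2; rewrite -{1}(density_mul hs).
  have /andP[_] : (piece_steps d s L)%:R <= s / d%:R * L%:R
      < (piece_steps d s L).+1%:R by rewrite truncn_itv // mulr_ge0.
  rewrite -addn1 natrD => /ltW /(ler_wpM2l (ler0n R d)); lra.
have hL : (1 - th) * B.+1%:R - (d%:R + 2) <= L%:R.
  have : (B <= L + (Num.truncn (th * B.+1%:R) + d.+1))%N.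
    by rewrite addnC -leq_subLR.
  have /andP[c1 _] := truncn_itv tB0.
  move: c1; rewrite -(ler_nat R) -[d.+1]addn1 -[B.+1]addn1 !natrD; lra.
apply: (@lt_le_trans _ _ (2 `^ (s * ((1 - th) * B.+1%:R) - D))); last first.
  apply: le_pow2; have := ler_wpM2l s0 hL; rewrite /D; lra.
have hT : C * 2 `^ D < 2 `^ (g * B.+1%:R).
  apply: lt_le_trans (truncnS_gt _) _; apply: (@le_trans _ _ (2 `^ T.+1%:R)).
    by rewrite pow2_natr -natrX ler_nat ltnW // ltn_expl.
  exact: le_pow2.
have -> : s * ((1 - th) * B.+1%:R) - D =
    g * B.+1%:R + (- D + (1 - th) * B.+1%:R * alpha) by rewrite /g; ring.
rewrite pow2D; set E := 2 `^ (_ * alpha).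
have -> : E = 2 `^ D * 2 `^ (- D + (1 - th) * B.+1%:R * alpha).
  by rewrite -pow2D; congr powR; ring.
by rewrite mulrA ltr_pM2r // pow2_gt0.
Qed.

(** * The equivalence, with pieces indexed by rational parameters *)

Theorem corollaryB (R : realType) (d : nat) (phi : R -> R)
    (phi_range : forall theta : R, 0 < theta < 1 -> 0 <= phi theta <= d%:R)
    (phi_incr : forall s t : R, 0 < s < 1 -> 0 < t < 1 ->
       s <= t -> phi s <= phi t) :
  (exists F : set 'rV[R]_d, forall theta : R, 0 < theta < 1 ->
     assouad_spectrum theta F = (phi theta)%:E) <->
  (forall s t : R, 0 < s < 1 -> 0 < t < 1 ->
     s <= t -> (1 - t) * phi t <= (1 - s) * phi s).
Proof.
split=> [[F hF] s t hs ht st|phi_decr].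
  have [s0 _] := andP hs; have [_ t1] := andP ht.
  exact: (spectrum_decreasing s0 st t1 (hF _ hs) (hF _ ht)).
pose rat01 (q : rat) : R := if 0 < (ratr q : R) < 1 then ratr q else 2^-1.
(* The second component makes each rational recur with every lower bound [k] on [B]. *)
pose P := (rat * nat)%type.
pose code (n : nat) : option P := unpickle n.
pose th n : R := if code n is Some (q, _) then rat01 q else 2^-1.
pose K n : nat := if code n is Some (_, k) then k else 0%N.
have half01 : 0 < (2^-1 : R) < 1 by lra.
have hth n : 0 < th n < 1.
  by rewrite /th; case: (code n) => [[q k]|] //; rewrite /rat01; case: ifP.
have [B [W [W0 hW hB hK]]] := scales_exist d K (fun n => proj1 (andP (hth n))).
exists [set y | exists n, piece (th n) (phi (th n)) (B n) y]%classic.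
move=> t ht; apply/eqP; rewrite eq_le; apply/andP; split.
  apply/lee_addgt0Pr => eps eps0; rewrite -EFinD; apply: assouad_spectrum_le.
  exact: pieces_exponent hW hB ht eps0.
apply: le_assouad_spectrum => alpha halpha.
have [t0 t1] := andP ht.
(* An exponent at [t] is transferred to [q > t], where the pieces bound it below by [phi q], and
   [phi t <= phi q]. *)
have key (q : rat) : t < (ratr q : R) < 1 ->
    (1 - (ratr q : R)) * phi t <= (1 - t) * alpha.
  move=> /andP[tq q1]; have q01 : 0 < (ratr q : R) < 1.
    by apply/andP; split=> //; exact: lt_trans tq.
  have := spectrum_exponent_transfer t0 (ltW tq) q1 halpha.
  move/(piece_exponent_ge (phi_range _ q01) q01) => h.
  have {}h : phi (ratr q) <= alpha * (1 - t) / (1 - ratr q).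
    apply: h => k; pose n := pickle ((q, k) : P).
    have cn : code n = Some (q, k) by rewrite /code pickleK.
    exists (B n); first by have := hK n; rewrite /K cn.
    by move=> y hy; exists n; rewrite /th cn /rat01 q01.
  rewrite ler_pdivlMr ?subr_gt0 // in h.
  apply: le_trans (_ : (1 - ratr q) * phi (ratr q) <= _); last lra.
  by rewrite ler_wpM2l ?subr_ge0 ?(ltW q1) // phi_incr // ltW.
rewrite leNgt; apply/negP => lt_alpha.
have [p0 _] := andP (phi_range _ ht).
have p1 : 0 < phi t + 1 by lra.
(* Closeness of [q] to [t] at which [key] fails if [alpha < phi t]; the [+ 1] keeps the denominator
   positive and the inequality strict. *)
pose e := (1 - t) * (phi t - alpha) / (phi t + 1).
have e0 : 0 < e by rewrite divr_gt0 // mulr_gt0 ?subr_gt0.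
have [q] : exists q : rat, ratr q \in `]t, Num.min 1 (t + e)[.
  by apply: rat_in_itvoo; rewrite lt_min t1 ltrDl.
rewrite in_itv /= lt_min => /and3P[tq q1 qe].
have := key q; rewrite tq q1 => /(_ isT); apply/negP; rewrite -ltNge.
have h : e * (phi t + 1) = (1 - t) * (phi t - alpha) by rewrite divfK ?gt_eqF.
have : (ratr q - t) * phi t <= e * phi t by rewrite ler_wpM2r //; lra.
lra.
Qed.
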